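(* Let $G$ be an affine game with a Left option $G^L$ of the form $G^L=\{G^{L\mathcal L}\mid\overline\infty\}$ (i.e. whose only Right option is $\overline\infty$). Then $G=\{(G^{\mathcal L}\setminus\{G^L\})\cup\{\overline\infty\}\mid G^{\mathcal R}\}$.
   Context: Affine games are defined recursively. There are two games without options, denoted $\infty$ and $\overline{\infty}$ (terminating games). Every other affine game is a form $G=\{G^{\mathcal L}\mid G^{\mathcal R}\}$, where $G^{\mathcal L}$ (Left options) and $G^{\mathcal R}$ (Right options) are non-empty finite sets of previously constructed affine games. Let $\mathbb A$ be the set of all affine games. $G^{L\mathcal L}$ denotes the set of Left options of $G^L$. Disjunctive sum: $G+H$ is undefined if one of $G,H$ is the form $\infty$ and the other is $\overline\infty$; it is $\infty$ if one is $\infty$ and the other is not $\overline\infty$; it is $\overline\infty$ if one is $\overline\infty$ and the other is not $\infty$; otherwise $G+H=\{G^{\mathcal L}+H,\,G+H^{\mathcal L}\mid G^{\mathcal R}+H,\,G+H^{\mathcal R}\}$. Outcomes: $o^L(G)=\mathbf L$ if $G=\infty$ or some $G^L\in G^{\mathcal L}$ has $o^R(G^L)=\mathbf L$, and $o^L(G)=\mathbf R$ otherwise; $o^R(G)=\mathbf R$ if $G=\overline\infty$ or some $G^R\in G^{\mathcal R}$ has $o^L(G^R)=\mathbf R$, and $o^R(G)=\mathbf L$ otherwise; $o(G)=(o^L(G),o^R(G))$. Equality of games: $G=H$ iff $o(G+X)=o(H+X)$ for all $X\in\mathbb A\setminus\{\infty,\overline\infty\}$; this is the equality in the conclusion. 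*)

(* Defs.v *)
From HB Require Import structures.
From mathcomp Require Import all_boot finmap.

Set Implicit Arguments.
Unset Strict Implicit.
Unset Printing Implicit Defensive.

Local Open Scope fset_scope.

(* Forms are hereditarily finite: two atoms, and pairs of finite sets of forms.
   Since {fset _} cannot be nested in an inductive type, a form is encoded as a
   tree whose lists of options are, at every level, the canonical enumerations
   of the sets they span. Leibniz equality on [form] is then identity of forms
   in the set-theoretic sense (see [formP], [left_options_node] and
   [right_options_node]). *)
Inductive tree := TInf | TBar | TNode of seq tree & seq tree.

Definition tree_all (P : tree -> Prop) : seq tree -> Prop :=
  foldr (fun t Q => P t /\ Q) True.

Fixpoint tree_nested_ind (P : tree -> Prop) (Pinf : P TInf) (Pbar : P TBar)
    (Pnode : forall l r, tree_all P l -> tree_all P r -> P (TNode l r))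
    (t : tree) : P t :=
  let fix all_ind (s : seq tree) : tree_all P s :=
    if s is u :: s' return tree_all P s
    then conj (tree_nested_ind Pinf Pbar Pnode u) (all_ind s') else I in
  match t with
  | TInf => Pinf
  | TBar => Pbar
  | TNode l r => Pnode l r (all_ind l) (all_ind r)
  end.

Fixpoint tree_encode (t : tree) : GenTree.tree bool :=
  match t with
  | TInf => GenTree.Leaf true
  | TBar => GenTree.Leaf false
  | TNode l r => GenTree.Node 0
      [:: GenTree.Node 0 (map tree_encode l); GenTree.Node 0 (map tree_encode r)]
  end.

Fixpoint tree_decode (t : GenTree.tree bool) : tree :=
  match t with
  | GenTree.Leaf b => if b then TInf else TBar
  | GenTree.Node _ [:: GenTree.Node _ l; GenTree.Node _ r] =>
      TNode (map tree_decode l) (map tree_decode r)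
  | _ => TInf
  end.

Lemma tree_encodeK : cancel tree_encode tree_decode.
Proof.
elim/tree_nested_ind => //= l r IHl IHr; congr TNode; rewrite -map_comp.
- by elim: l IHl => //= u l IH [-> /IH ->].
- by elim: r IHr => //= u r IH [-> /IH ->].
Qed.

HB.instance Definition _ := Choice.copy tree (can_type tree_encodeK).

Lemma tree_ind_mem (P : tree -> Prop) :
  P TInf -> P TBar ->
  (forall l r : seq tree, (forall t, t \in l -> P t) ->
     (forall t, t \in r -> P t) -> P (TNode l r)) ->
  forall t, P t.
Proof.
move=> Pinf Pbar Pnode; elim/tree_nested_ind => // l r IHl IHr.
have mem_all s : tree_all P s -> forall t, t \in s -> P t.
  elim: s => //= u s IHs [Pu Ps] t; rewrite inE.
  by case/predU1P => [-> //|]; apply: IHs.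
by apply: Pnode; apply: mem_all.
Qed.

Definition enum_set (K : choiceType) (s : seq K) : seq K := seq_fset tt s.

Arguments enum_set : simpl never.

Lemma mem_enum_set (K : choiceType) (s : seq K) : enum_set s =i s.
Proof. exact: seq_fsetE. Qed.

Lemma eq_enum_set (K : choiceType) (s s' : seq K) :
  s =i s' -> enum_set s = enum_set s'.
Proof.
move=> ss'; congr enum_fset; apply/fsetP => x.
by rewrite !seq_fsetE ss'.
Qed.

Fixpoint normal (t : tree) : tree :=
  match t with
  | TInf => TInf
  | TBar => TBar
  | TNode l r => TNode (enum_set (map normal l)) (enum_set (map normal r))
  end.

Lemma normal_idem t : normal (normal t) == normal t.
Proof.
apply/eqP; elim/tree_ind_mem: t => //= l r IHl IHr.
have fixed (s : seq tree) : (forall t, t \in s -> normal (normal t) = normal t) ->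
    enum_set (map normal (enum_set (map normal s))) = enum_set (map normal s).
  move=> IH; rewrite (_ : map normal (enum_set _) = enum_set (map normal s)).
    exact/eq_enum_set/mem_enum_set.
  rewrite -[RHS]map_id; apply/eq_in_map => u.
  by rewrite mem_enum_set => /mapP[t ts ->]; apply: IH.
by rewrite !fixed.
Qed.

Record form := Form { tree_of : tree; _ : normal tree_of == tree_of }.

HB.instance Definition _ := [isSub for tree_of].
HB.instance Definition _ := [Equality of form by <:].
HB.instance Definition _ := [Choice of form by <:].

Definition canon (t : tree) : form := Form (normal_idem t).

Lemma normal_tree_of (G : form) : normal (tree_of G) = tree_of G.
Proof. by apply/eqP; case: G. Qed.

Lemma canonK (G : form) : canon (tree_of G) = G.
Proof. by apply: val_inj; apply: normal_tree_of. Qed.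

Definition inf : form := canon TInf.
Definition barinf : form := canon TBar.

Definition node (A B : {fset form}) : form :=
  canon (TNode (map tree_of A) (map tree_of B)).

Definition left_options (G : form) : {fset form} :=
  if tree_of G is TNode l _ then seq_fset tt (map canon l) else fset0.

Definition right_options (G : form) : {fset form} :=
  if tree_of G is TNode _ r then seq_fset tt (map canon r) else fset0.

Lemma options_node (A : {fset form}) :
  seq_fset tt (map canon (enum_set (map normal (map tree_of A)))) = A.
Proof.
apply/fsetP => G; rewrite seq_fsetE; apply/mapP/idP => [[t]|GA].
- by rewrite mem_enum_set -map_comp => /mapP[H HA -> ->] /=;
    rewrite normal_tree_of canonK.
- exists (tree_of G); last by rewrite canonK.
  by rewrite mem_enum_set -map_comp; apply/mapP; exists G; rewrite //= normal_tree_of.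
Qed.

Lemma left_options_node A B : left_options (node A B) = A.
Proof. exact: options_node. Qed.

Lemma right_options_node A B : right_options (node A B) = B.
Proof. exact: options_node. Qed.

Lemma node_neq_inf A B : node A B != inf. Proof. by []. Qed.
Lemma node_neq_barinf A B : node A B != barinf. Proof. by []. Qed.
Lemma inf_neq_barinf : inf != barinf. Proof. by []. Qed.

Lemma left_options_inf : left_options inf = fset0. Proof. by []. Qed.
Lemma right_options_inf : right_options inf = fset0. Proof. by []. Qed.
Lemma left_options_barinf : left_options barinf = fset0. Proof. by []. Qed.
Lemma right_options_barinf : right_options barinf = fset0. Proof. by []. Qed.

Lemma canonK_options (G : form) (l r : seq tree) : tree_of G = TNode l r ->
  {in l, forall t, normal t = t} /\ {in r, forall t, normal t = t}.
Proof.
move=> EG; have := normal_tree_of G; rewrite EG => -[El Er].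
have fixed (s : seq tree) :
    enum_set (map normal s) = s -> {in s, forall t, normal t = t}.
  move=> Es t; rewrite -{1}Es mem_enum_set => /mapP[u _ ->].
  by apply/eqP; apply: normal_idem.
by split; apply: fixed.
Qed.

Lemma formP (G : form) : [\/ G = inf, G = barinf | G = node (left_options G) (right_options G)].
Proof.
case EG: (tree_of G) => [||l r].
- by apply: Or31; rewrite -(canonK G) EG.
- by apply: Or32; rewrite -(canonK G) EG.
apply: Or33; have [nl nr] := canonK_options EG.
have optE (s : seq tree) : {in s, forall t, normal t = t} ->
    map normal (map tree_of (seq_fset tt (map canon s))) =i map normal s.
  move=> ns t; rewrite -map_comp; apply/mapP/mapP => [[H]|[u us ->]].
    by rewrite seq_fsetE => /mapP[u us ->] ->; exists u; rewrite //= !(ns u us).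
  by exists (canon u); [rewrite seq_fsetE map_f | rewrite /= !(ns u us)].
apply: val_inj; rewrite /= -normal_tree_of /left_options /right_options EG /=.
by congr TNode; apply/esym/eq_enum_set/optE.
Qed.

Lemma form_nodeP (G : form) :
  G = node (left_options G) (right_options G) -> exists A B, G = node A B.
Proof. by exists (left_options G), (right_options G). Qed.

Lemma form_ind_mem (P : form -> Prop) :
  P inf -> P barinf ->
  (forall A B : {fset form}, (forall G, G \in A -> P G) ->
     (forall G, G \in B -> P G) -> P (node A B)) ->
  forall G, P G.
Proof.
move=> Pinf Pbar Pnode G; rewrite -(canonK G).
have: normal (tree_of G) = tree_of G by apply: normal_tree_of.
elim/tree_ind_mem: (tree_of G) => // l r IHl IHr Elr.
have [nl nr]: {in l, forall t, normal t = t} /\ {in r, forall t, normal t = t}.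
  exact: (@canonK_options (canon (TNode l r)) l r Elr).
have [//|//|->] := formP (canon (TNode l r)).
have lE : left_options (canon (TNode l r)) = seq_fset tt (map canon l).
  by rewrite /left_options [tree_of _]Elr.
have rE : right_options (canon (TNode l r)) = seq_fset tt (map canon r).
  by rewrite /right_options [tree_of _]Elr.
apply: Pnode => H; rewrite ?lE ?rE seq_fsetE => /mapP[t ts ->].
- by apply: IHl => //; apply: nl.
- by apply: IHr => //; apply: nr.
Qed.

(* [form] also contains forms with an empty set of options; they are not affine. *)
Inductive affine : form -> Prop :=
| affine_inf : affine inf
| affine_barinf : affine barinf
| affine_node (A B : {fset form}) :
    A != fset0 -> B != fset0 ->
    (forall G, G \in A -> affine G) -> (forall G, G \in B -> affine G) ->
    affine (node A B).

Inductive player := Left | Right.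

Definition is_Left (p : player) : bool := if p is Left then true else false.

Fixpoint tree_outcome (t : tree) : player * player :=
  match t with
  | TInf => (Left, Left)
  | TBar => (Right, Right)
  | TNode l r =>
      (if has (fun u => is_Left (tree_outcome u).2) l then Left else Right,
       if has (fun u => ~~ is_Left (tree_outcome u).1) r then Right else Left)
  end.

Definition outcome (G : form) : player * player := tree_outcome (tree_of G).
Definition outcomeL (G : form) : player := (outcome G).1.
Definition outcomeR (G : form) : player := (outcome G).2.

Lemma outcomeLP (G : form) : outcomeL G = Left <->
  G = inf \/ exists2 GL, GL \in left_options G & outcomeR GL = Left.
Proof.
have [->|->|nG] := formP G; first by split=> // _; left.
- by split=> // -[|[GL]].
have [A [B ->]] := form_nodeP nG; rewrite left_options_node /outcomeL /outcome /=.
set b := has _ _; have -> : b = has (fun H => is_Left (outcomeR H)) A.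
  rewrite /b (eq_has_r (mem_enum_set _)) -map_comp has_map.
  by apply: eq_has => H; rewrite /= normal_tree_of.
case: hasP => [[H HA oH]|nH].
  by split=> // _; right; exists H => //; case: (outcomeR H) oH.
by split=> // -[/eqP //|[H HA oH]]; case: nH; exists H; rewrite ?oH.
Qed.

Lemma outcomeRP (G : form) : outcomeR G = Right <->
  G = barinf \/ exists2 GR, GR \in right_options G & outcomeL GR = Right.
Proof.
have [->|->|nG] := formP G; last first.
- have [A [B ->]] := form_nodeP nG; rewrite right_options_node /outcomeR /outcome /=.
  set b := has _ _; have -> : b = has (fun H => ~~ is_Left (outcomeL H)) B.
    rewrite /b (eq_has_r (mem_enum_set _)) -map_comp has_map.
    by apply: eq_has => H; rewrite /= normal_tree_of.
  case: hasP => [[H HB oH]|nH].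
    by split=> // _; right; exists H => //; case: (outcomeL H) oH.
  by split=> // -[/eqP //|[H HB oH]]; case: nH; exists H; rewrite ?oH.
- by split=> // _; left.
- by split=> // -[|[GR]].
Qed.

(* [None] means that the sum is undefined; this only happens for two terminating
   games (see [game_sum_None]), hence [pmap] below never discards an option. *)
Fixpoint tree_sum (s : tree) : tree -> option tree :=
  fix tree_sum_s (t : tree) : option tree :=
  match s, t with
  | TInf, TBar => None
  | TBar, TInf => None
  | TInf, _ => Some TInf
  | _, TInf => Some TInf
  | TBar, _ => Some TBar
  | _, TBar => Some TBar
  | TNode sl sr, TNode tl tr =>
      Some (TNode (pmap (fun u => tree_sum u t) sl ++ pmap tree_sum_s tl)
                  (pmap (fun u => tree_sum u t) sr ++ pmap tree_sum_s tr))
  end.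

Definition game_sum (G H : form) : option form :=
  omap canon (tree_sum (tree_of G) (tree_of H)).

Lemma game_sum_inf_barinf : game_sum inf barinf = None. Proof. by []. Qed.
Lemma game_sum_barinf_inf : game_sum barinf inf = None. Proof. by []. Qed.

Lemma game_sum_inf_l G : G != barinf -> game_sum inf G = Some inf.
Proof. by have [->|->|->] := formP G. Qed.

Lemma game_sum_inf_r G : G != barinf -> game_sum G inf = Some inf.
Proof. by have [->|->|->] := formP G. Qed.

Lemma game_sum_barinf_l G : G != inf -> game_sum barinf G = Some barinf.
Proof. by have [->|->|->] := formP G. Qed.

Lemma game_sum_barinf_r G : G != inf -> game_sum G barinf = Some barinf.
Proof. by have [->|->|->] := formP G. Qed.

Lemma game_sum_None G H : game_sum G H = None <->
  G = inf /\ H = barinf \/ G = barinf /\ H = inf.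
Proof.
split; last by case=> -[-> ->].
have [->|->|->] := formP G; have [->|->|->] := formP H => // _; first by left.
by right.
Qed.

Lemma game_sum_node (A B C D : {fset form}) :
  let G := node A B in
  let H := node C D in
  game_sum G H = Some (node
    (seq_fset tt (pmap (game_sum^~ H) A) `|` seq_fset tt (pmap (game_sum G) C))
    (seq_fset tt (pmap (game_sum^~ H) B) `|` seq_fset tt (pmap (game_sum G) D))).
Proof.
move=> G H.
have optE (f g : tree -> option tree) (A' C' : {fset form}) :
    map normal
      (pmap f (enum_set (map normal (map tree_of A'))) ++
       pmap g (enum_set (map normal (map tree_of C')))) =i
    map normal (map tree_of
      (seq_fset tt (pmap (fun K => omap canon (f (tree_of K))) A') `|`
       seq_fset tt (pmap (fun K => omap canon (g (tree_of K))) C'))).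
  have memE (h : tree -> option tree) (E : {fset form}) t :
      (t \in map normal (pmap h (enum_set (map normal (map tree_of E))))) =
      (t \in map tree_of (pmap (fun K => omap canon (h (tree_of K))) E)).
    apply/mapP/mapP => [[u]|[K]]; rewrite mem_pmap => /mapP.
    - case=> v; rewrite mem_enum_set -map_comp => /mapP[K KE ->] /= hK ->.
      exists (canon u) => //; rewrite mem_pmap; apply/mapP; exists K => //.
      by rewrite -normal_tree_of -hK.
    - case=> K' K'E; case hK: (h _) => [u|] //= [->] ->.
      exists u => //; rewrite mem_pmap; apply/mapP; exists (tree_of K') => //.
      rewrite mem_enum_set -map_comp; apply/mapP; exists K' => //=.
      by rewrite normal_tree_of.
  move=> t; rewrite map_cat mem_cat !memE -map_comp.
  apply/orP/mapP => [[/mapP|/mapP] [K KE ->]|[K]].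
  - by exists K; [rewrite in_fsetU !seq_fsetE KE | rewrite /= normal_tree_of].
  - by exists K; [rewrite in_fsetU !seq_fsetE KE orbT | rewrite /= normal_tree_of].
  rewrite in_fsetU !seq_fsetE /= normal_tree_of => /orP[] KE ->; [left|right];
  exact: map_f.
congr Some; apply: val_inj => /=; congr TNode; apply: eq_enum_set => t.
- exact: optE.
- exact: optE.
Qed.

(* Equality in the theory of affine games, as opposed to identity of forms. *)
Definition game_eq (G H : form) : Prop :=
  forall X : form, affine X -> X <> inf -> X <> barinf ->
    omap outcome (game_sum G X) = omap outcome (game_sum H X).

(* Main.v *)
Require Import Defs.
From mathcomp Require Import all_boot finmap.

Local Open Scope fset_scope.

Local Arguments seq_fset : simpl never.

(* The idea: Right answers a Left move to [GL] by moving to [barinf], so in a sum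
   with a nonterminating game the move to [GL] loses at once, exactly as a Left
   move to [barinf] does. Induction on the other summand handles the rest. *)

(** A sum of two nodes is a node, never [inf], so Left can win only through a move in one component.
    Demanding [Some Left] also rules out undefined sums, just as [pmap] does. *)
Lemma outcomeL_sum_node (A B C D : {fset form}) :
  omap outcomeL (game_sum (node A B) (node C D)) = Some Left <->
  (exists2 H, H \in A & omap outcomeR (game_sum H (node C D)) = Some Left) \/
  (exists2 H, H \in C & omap outcomeR (game_sum (node A B) H) = Some Left).
Proof.
rewrite game_sum_node /=; split=> [[/outcomeLP[/eqP//|[K]]]|K].
  rewrite left_options_node in_fsetU !seq_fsetE !mem_pmap.
  by case/orP=> /mapP[H HS EK] oK; [left|right]; exists H; rewrite // -EK /= oK.
congr Some; apply/outcomeLP; right.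
case: K => -[H HS]; case EK: (game_sum _ _) => [K|] //= [oK]; exists K => //;
  rewrite left_options_node in_fsetU !seq_fsetE !mem_pmap -EK.
- by rewrite (map_f (game_sum^~ _) HS).
- by rewrite (map_f (game_sum _) HS) orbT.
Qed.

Lemma outcomeR_sum_node (A B C D : {fset form}) :
  omap outcomeR (game_sum (node A B) (node C D)) = Some Right <->
  (exists2 H, H \in B & omap outcomeL (game_sum H (node C D)) = Some Right) \/
  (exists2 H, H \in D & omap outcomeL (game_sum (node A B) H) = Some Right).
Proof.
rewrite game_sum_node /=; split=> [[/outcomeRP[/eqP//|[K]]]|K].
  rewrite right_options_node in_fsetU !seq_fsetE !mem_pmap.
  by case/orP=> /mapP[H HS EK] oK; [left|right]; exists H; rewrite // -EK /= oK.
congr Some; apply/outcomeRP; right.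
case: K => -[H HS]; case EK: (game_sum _ _) => [K|] //= [oK]; exists K => //;
  rewrite right_options_node in_fsetU !seq_fsetE !mem_pmap -EK.
- by rewrite (map_f (game_sum^~ _) HS).
- by rewrite (map_f (game_sum _) HS) orbT.
Qed.

(** Each outcome takes two values, so agreement on one of them suffices: the one that the option
    lemmas characterise, a win for the player who moves first. *)
Lemma eq_outcome_sum (A B A' B' C D : {fset form}) :
  let oL G H := omap outcomeL (game_sum G H) in
  let oR G H := omap outcomeR (game_sum G H) in
  (oL (node A B) (node C D) = Some Left <->
   oL (node A' B') (node C D) = Some Left) ->
  (oR (node A B) (node C D) = Some Right <->
   oR (node A' B') (node C D) = Some Right) ->
  omap outcome (game_sum (node A B) (node C D)) =
  omap outcome (game_sum (node A' B') (node C D)).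
Proof.
move=> oL oR; rewrite /oL /oR !game_sum_node; set S := node (_ `|` _) _.
set S' := node (_ `|` _) _; move: S S' => S S'; rewrite /outcomeL /outcomeR /=.
case: (outcome S) => a b; case: (outcome S') => c d /= [L1 L2] [R1 R2].
by congr (Some (_, _)); [case: a c L1 L2 {R1 R2} => -[] // L1 L2
  | case: b d R1 R2 {L1 L2} => -[] // L1 L2]; first [have := L1 erefl | have := L2 erefl].
Qed.

(** Right moves to [barinf], which absorbs the node [node C D] and is won by Right. *)
Lemma outcomeR_sum_barinf_option (A B C D : {fset form}) : barinf \in B ->
  omap outcomeR (game_sum (node A B) (node C D)) = Some Right.
Proof. by move=> Bbar; apply/outcomeR_sum_node; left; exists barinf. Qed.

Theorem theorem40 (G GL : form) :
  affine G ->
  GL \in left_options G ->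
  GL = node (left_options GL) [fset barinf] ->
  game_eq G (node ((left_options G `\ GL) `|` [fset barinf]) (right_options G)).
Proof.
move=> _ GLG EGL X _ _ _.
have [EG|EG|EG] := formP G; [by rewrite EG in GLG | by rewrite EG in GLG |].
move: EG GLG; move: (left_options G) (right_options G) => A B -> GLA {G}.
set A' := (A `\ GL) `|` [fset barinf].
(* The induction covers terminating [X] too, since they occur as options of nodes; such an [X]
   absorbs both games. *)
elim/form_ind_mem: X => [||C D IHC IHD].
- by rewrite !game_sum_inf_r.
- by rewrite !game_sum_barinf_r.
have eq_proj (f : player * player -> player) H :
    omap outcome (game_sum (node A B) H) = omap outcome (game_sum (node A' B) H) ->
    omap (fun K => f (outcome K)) (game_sum (node A B) H) =
    omap (fun K => f (outcome K)) (game_sum (node A' B) H).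
  by case: (game_sum _ _) => [?|]; case: (game_sum _ _) => [?|] //= [->].
apply: eq_outcome_sum.
- split=> /outcomeL_sum_node[] [H HS oH]; apply/outcomeL_sum_node.
  + left; exists H => //; rewrite in_fsetU in_fsetD1 HS andbT.
    (* The move [H] survives in [A'] unless it is [GL], where Right would reply with [barinf] and
       win. *)
    apply/orP; left; apply/eqP => EH; move: oH.
    by rewrite EH EGL outcomeR_sum_barinf_option // in_fset1.
  + by right; exists H => //; rewrite -(eq_proj snd _ (IHC H HS)).
  + move: HS oH; rewrite in_fsetU in_fsetD1 in_fset1.
    case/orP => [/andP[_ HA] oH|/eqP ->]; first by left; exists H.
    (* The added option [barinf] absorbs [node C D], so it cannot be a winning move for Left. *)
    by rewrite game_sum_barinf_l.
  + by right; exists H => //; rewrite [LHS](eq_proj snd _ (IHC H HS)).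
(* Both games have the Right options [B], so only moves in [X] call for the induction hypothesis. *)
- split=> /outcomeR_sum_node[] [H HS oH]; apply/outcomeR_sum_node.
  + by left; exists H.
  + by right; exists H => //; rewrite -(eq_proj fst _ (IHD H HS)).
  + by left; exists H.
  + by right; exists H => //; rewrite [LHS](eq_proj fst _ (IHD H HS)).
Qed.
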